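(* Let $(\mathbb{X},\|\cdot\|)$ be a finite dimensional normed vector space, $\mathcal{K}\subseteq\mathbb{X}$ a compact convex set, $l:\mathbb{X}\to\mathbb{R}$ and $r:\mathcal{K}\to\mathbb{R}_{\ge0}$ closed convex functions, and $f=l+r$. Let $\mathcal{A}$ be an optimistic online algorithm generating $x_t\in\mathcal{K}$ at iteration $t$, and consider the stochastic acceleration scheme described in the context, with weights $a_t=t$, averaged iterates $z_t$ and stochastic gradients $g_t$ queried at $z_t$. Denote by $$\nu_t^2=\mathbb{E}\big[\|g_t-\nabla l(z_t)\|_*^2\,\big|\,z_t\big]$$ the variance. If $\mathcal{A}$ has a regret upper bound in the form of $$\sum_{t=1}^T a_t\big(\langle g_t,x_t-x\rangle+r(x_t)-r(x)\big)\le c_1+c_2\sqrt{\sum_{t=1}^T\|a_t(g_t-g_{t-1})\|_*^2}\qquad\text{for all }x\in\mathcal{K},$$ then there is some $L>0$ such that for all $x\in\mathcal{K}$ $$\mathbb{E}[f(z_T)-f(x)]\le\frac{c_1+c_2\sqrt{8\sum_{t=1}^T a_t^2(\nu_t^2+L^2)}}{a_{1:T}}.$$ Furthermore, if $l$ is $M$-smooth, then for all $x\in\mathcal{K}$ $$\mathbb{E}[f(z_T)-f(x)]\le\frac{c_1+c_2\sqrt{8\sum_{t=1}^T a_t^2\nu_t^2}+\sqrt2\,c_2L+2Mc_2^2}{a_{1:T}}.$$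
   Context: $\|\cdot\|_*$ is the dual norm on the dual space $\mathbb{X}_*$, $\langle\cdot,\cdot\rangle$ the pairing, and $a_{1:t}=\sum_{s=1}^t a_s$. The function $l$ is $M$-smooth if $l(x)\le l(y)+\langle\nabla l(y),x-y\rangle+\frac M2\|x-y\|^2$ for all $x,y\in\mathbb{X}$. Stochastic acceleration scheme. For $t=1,\dots,T$: set $a_t=t$; obtain $x_t\in\mathcal{K}$ from $\mathcal{A}$; set $z_t=\frac{a_t}{a_{1:t}}x_t+\big(1-\frac{a_t}{a_{1:t}}\big)z_{t-1}$ (so $z_1=x_1$); query a stochastic gradient $g_t\in\mathbb{X}_*$ such that $\mathbb{E}[g_t\mid z_t]\in\partial l(z_t)$, and write $\nabla l(z_t)=\mathbb{E}[g_t\mid z_t]$; update $\mathcal{A}$ with decision set $\mathcal{K}$, composite term $a_{t+1}r$, scaled subgradient $a_tg_t$ and hint $a_{t+1}g_t$ for the next round. The first hint is zero, i.e. $g_0=0$. The regret of $\mathcal{A}$ is the regret with respect to the scaled losses $a_tg_t$ and the composite terms $a_tr$. The constants $c_1,c_2\ge0$ come from the regret bound of $\mathcal{A}$. The conditional expectation given $z_t$ is understood as conditioning on the history up to and including the choice of $z_t$ (so that $x_t$ and $z_{t-1}$ are fixed when $z_t$ is given), and $\nu_t^2$ is treated as a number. *)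

(* Defs.v *)
From HB Require Import structures.
From mathcomp Require Import all_boot all_order all_algebra.
From mathcomp Require Import all_classical all_reals all_analysis.

Set Implicit Arguments.
Unset Strict Implicit.
Unset Printing Implicit Defensive.

Import Order.TTheory GRing.Theory Num.Theory.
Import numFieldNormedType.Exports.

Local Open Scope classical_set_scope.
Local Open Scope ring_scope.

(* Finite dimensional normed spaces: [Vector] supplies finite dimensionality,
   the norm is arbitrary. *)
#[short(type="normedVectType")]
HB.structure Definition NormedVector (R : numDomainType) :=
  {V of NormedModule R V & Vector R V}.

(* In finite dimension every linear form is continuous, so 'Hom(X, R^o) is the
   whole dual space; the pairing <g, x> is the application g x. *)

Section Convex.
Variables (R : realType) (X : normedVectType R).

Definition dual_norm (g : 'Hom(X, R^o)) : R :=
  sup [set g v | v in [set v : X | `|v| <= 1]].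

Definition closed_function (D : set X) (f : X -> R) : Prop :=
  closed [set p : X * R | D p.1 /\ f p.1 <= p.2].

Definition subdifferential (f : X -> R) (z : X) : set 'Hom(X, R^o) :=
  [set g | forall x, f z + g (x - z) <= f x].

Definition smooth (M : R) (f : X -> R) : Prop :=
  (forall y, differentiable f y) /\
  forall x y, f x <= f y + 'd f y (x - y) + M / 2 * `|x - y| ^+ 2.

End Convex.

Section Conditioning.
Variables (R : realType) (d : measure_display) (Omega : measurableType d).

(* Borel measurability with respect to a sub-sigma-algebra F of Omega. *)
Definition measurable_wrt (V : topologicalType) (F : set (set Omega))
    (Y : Omega -> V) : Prop :=
  forall B : set V, <<s open >> B -> F (Y @^-1` B).

(* Z is a version of E[Y | F]. *)
Definition is_cond_exp (P : probability Omega R) (F : set (set Omega))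
    (Y Z : Omega -> R) : Prop :=
  [/\ P.-integrable setT (EFin \o Y),
      P.-integrable setT (EFin \o Z),
      measurable_wrt F Z &
      forall B, F B ->
        (\int[P]_(w in B) (Y w)%:E = \int[P]_(w in B) (Z w)%:E)%E].

(* The same for random linear forms: the dual space being finite dimensional,
   conditional expectation is tested against every vector. *)
Definition is_cond_exp_dual (X : normedVectType R) (P : probability Omega R)
    (F : set (set Omega)) (Y Z : Omega -> 'Hom(X, R^o)) : Prop :=
  forall v : X, is_cond_exp P F (fun w => Y w v) (fun w => Z w v).

End Conditioning.

Section Scheme.
Variables (R : realType) (X : normedVectType R).

Definition weight (t : nat) : R := t%:R.

Definition cumweight (t : nat) : R := \sum_(1 <= s < t.+1) weight s.

(* The value at 0 is irrelevant: the coefficient of z_0 in z_1 is 0. *)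
Fixpoint averaged (x : nat -> X) (t : nat) : X :=
  if t is s.+1 then
    (weight t / cumweight t) *: x t +
    (1 - weight t / cumweight t) *: averaged x s
  else 0.

Record update := Update {
  decision_set : set X;
  composite : X -> R;
  subgradient : 'Hom(X, R^o);
  hint : 'Hom(X, R^o)
}.

Variables (d : measure_display) (Omega : measurableType d).

(* The algorithm maps the updates received so far to its next point; the
   argument in Omega allows for internal randomization. *)
Definition online_algorithm := Omega -> seq update -> X.

(* Update performed at the end of round t.  For t = 0, where weight 0 = 0 and
   g_0 = 0, this is the initialization: composite term a_1 r, hint 0. *)
Definition scheme_update (K : set X) (r : X -> R)
    (g : nat -> Omega -> 'Hom(X, R^o)) (w : Omega) (t : nat) : update :=
  Update K (fun x => weight t.+1 * r x)
    (weight t *: g t w) (weight t.+1 *: g t w).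

Definition played (A : online_algorithm) (K : set X) (r : X -> R)
    (g : nat -> Omega -> 'Hom(X, R^o)) (t : nat) (w : Omega) : X :=
  A w [seq scheme_update K r g w s | s <- iota 0 t].

Definition queried (A : online_algorithm) (K : set X) (r : X -> R)
    (g : nat -> Omega -> 'Hom(X, R^o)) (t : nat) (w : Omega) : X :=
  averaged (fun s => played A K r g s w) t.

(* F t is the history up to and including the choice of z_t: it determines
   x_1, ..., x_t (hence z_1, ..., z_t) and g_1, ..., g_(t-1), and it may also
   contain the internal randomness of the algorithm. *)
Record is_history (T : nat) (F : nat -> set (set Omega))
    (x : nat -> Omega -> X) (g : nat -> Omega -> 'Hom(X, R^o)) : Prop := {
  history_sigma_algebra : forall t, sigma_algebra setT (F t);
  history_measurable : forall t, F t `<=` measurable;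
  history_increasing : forall s t, (s <= t)%N -> F s `<=` F t;
  history_point : forall t, (1 <= t <= T)%N -> measurable_wrt (F t) (x t);
  history_gradient : forall t, (1 <= t < T)%N ->
    forall v : X, measurable_wrt (F t.+1) (fun w => g t w v)
}.

(* gradl t is the version of E[g_t | F t] denoted by nabla l (z_t), and nu t is
   the (deterministic) conditional standard deviation of g_t. *)
Record acceleration_scheme (P : probability Omega R) (T : nat)
    (K : set X) (l r : X -> R) (A : online_algorithm)
    (F : nat -> set (set Omega)) (g gradl : nat -> Omega -> 'Hom(X, R^o))
    (nu : nat -> R) : Prop := {
  scheme_first_hint : forall w, g 0%N w = 0;
  scheme_in : forall t w, (1 <= t <= T)%N -> K (played A K r g t w);
  scheme_history : is_history T F (played A K r g) g;
  scheme_gradient : forall t, (1 <= t <= T)%N ->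
    is_cond_exp_dual P (F t) (g t) (gradl t);
  scheme_subgradient : forall t, (1 <= t <= T)%N ->
    {ae P, forall w, subdifferential l (queried A K r g t w) (gradl t w)};
  scheme_variance : forall t, (1 <= t <= T)%N ->
    is_cond_exp P (F t) (fun w => dual_norm (g t w - gradl t w) ^+ 2)
      (cst (nu t ^+ 2))
}.

Definition regret_bound (P : probability Omega R) (T : nat)
    (K : set X) (r : X -> R) (A : online_algorithm)
    (g : nat -> Omega -> 'Hom(X, R^o)) (c1 c2 : R) : Prop :=
  {ae P, forall w, forall x, K x ->
    \sum_(1 <= t < T.+1) weight t *
      (g t w (played A K r g t w - x) + r (played A K r g t w) - r x)
    <= c1 + c2 * Num.sqrt (\sum_(1 <= t < T.+1)
         dual_norm (weight t *: (g t w - g t.-1 w)) ^+ 2)}.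

End Scheme.

Arguments weight {R} t.
Arguments cumweight {R} t.

(* Main.v *)
Require Import Defs.
From HB Require Import structures.
From mathcomp Require Import all_boot all_order all_algebra.
From mathcomp Require Import all_classical all_reals all_analysis.
From mathcomp Require Import measurable_realfun ring lra.

Set Implicit Arguments.
Unset Strict Implicit.
Unset Printing Implicit Defensive.

Import Order.TTheory GRing.Theory Num.Theory.
Import numFieldNormedType.Exports.

Local Open Scope classical_set_scope.
Local Open Scope ring_scope.

(** Write [A t = a_1 + ... + a_t], [G t] for the subgradient [E[g_t | F_t]] of
    [l] at [z_t], and [B t = l (z_(t-1)) - l (z_t) - <G t, z_(t-1) - z_t>] for
    the Bregman gap, which is nonnegative because [G t] is a subgradient.
    Since [A t *: z_t = a_t *: x_t + A (t-1) *: z_(t-1)], the weighted gradient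
    inequalities at [z_t] telescope to
      [A T (l (z_T) - l u) + \sum_t A (t-1) B t
         <= \sum_t a_t <G t, x_t - u>]   ([anytime_bound]),
    while [A T r (z_T) <= \sum_t a_t r (x_t)] by convexity.  Replacing [G t] by
    [g_t] costs the noise [\sum_t a_t <G t - g_t, x_t - u>], and the regret
    bound then gives, for almost every outcome ([pathwise_regret]),
      [A T (f (z_T) - f u)
         <= c1 + c2 sqrt V - \sum_t A (t-1) B t + noise],
    where [V = \sum_t |a_t (g_t - g_(t-1))|^2].

    Let [e_t = |g_t - G t|] and [delta_t = |G t - G (t-1)|], so that
    [|g_t - g_(t-1)| <= e_t + e_(t-1) + delta_t].  The weight of [e_(t-1)] in [V]
    is [a_t], which is larger than [a_(t-1)]; a Young inequality with unequal
    coefficients still yields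
      [\sum_t a_t^2 (e_t + e_(t-1))^2 <= 7 \sum_t a_t^2 e_t^2]
    ([consecutive_weighted_sum_le]).
    - If only [|G t| <= L0] is known, then [delta_t <= 2 L0], and the room
      between 7 and 8 absorbs the cross terms, with [L = 2 L0]
      ([pathwise_lipschitz]).  Such an [L0] exists because a convex function on
      a finite dimensional space is bounded on bounded sets, hence has bounded
      subgradients on a compact set ([subgradient_bounded]).
    - If [l] is [M]-smooth, Minkowski's inequality separates the noise from
      [\sum_t a_t^2 delta_t^2].  Cocoercivity gives [delta_t^2 <= 2 M B t]
      ([smooth_cocoercive]), and [a_t^2 <= 4 A (t-1)] for [t >= 2], so the drift
      is at most [L0^2 + 8 M D] with [D = \sum_t A (t-1) B t]; the negative term
      [- D] compensates it, as [c2 sqrt (8 M D) - D <= 2 M c2^2]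
      ([pathwise_smooth]).

    It remains to take expectations.  The noise has mean zero, because [x_t] is
    determined by the history and bounded ([conditional_noise_mean0]); the
    square root is handled by the concavity inequality
    [sqrt N <= N / (2 s) + s / 2] with [s] close to [sqrt (E N)]
    ([expectation_sqrt_le]).  The bound on [f (z_T) - f u] is integrated by
    monotonicity of the lower integral, which asks for no measurability of
    [f (z_T)]. *)

(** * Norms in finite dimension *)

Section FiniteDimension.
Variables (R : realType) (X : normedVectType R).

Local Notation dim := (\dim {: X}).
Local Notation basis := (vbasis {: X}).

Lemma coord_fullv (v : X) : v = \sum_(i < dim) coord basis i v *: basis`_i.
Proof. exact/coord_vbasis/memvf. Qed.

Lemma combination_continuous (s : seq 'I_dim) :
  continuous (fun c : 'rV[R]_dim => \sum_(i <- s) c ord0 i *: basis`_i).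
Proof.
elim: s => [|j s IHs].
  rewrite (_ : (fun c => _) = cst 0); first apply: cst_continuous.
  by apply/funext => c; rewrite big_nil.
rewrite (_ : (fun c => _) = (fun c : 'rV[R]_dim => c ord0 j *: basis`_j +
    \sum_(i <- s) c ord0 i *: basis`_i)); last first.
  by apply/funext => c; rewrite big_cons.
move=> c; apply: (@cvgD _ _ _ (nbhs c)); last exact: IHs.
apply: (@cvgZr_tmp _ _ _ (nbhs c)); exact: coord_continuous.
Qed.

(** All norms are equivalent in finite dimension: the norm of a linear
    combination of the basis is continuous in the coefficients and does not
    vanish on their unit sphere, which is compact, so it has a positive minimum
    there. *)
Lemma coord_bounded :
  exists2 C : R, 0 < C &
    forall (v : X) (i : 'I_dim), `|coord basis i v| <= C * `|v|.
Proof.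
pose comb (c : 'rV[R]_dim) : X := \sum_(i < dim) c ord0 i *: basis`_i.
have comb_coord v : comb (\row_i coord basis i v) = v.
  by rewrite [RHS]coord_fullv; apply: eq_bigr => i _; rewrite mxE.
have combZ a c : comb (a *: c) = a *: comb c.
  by rewrite scaler_sumr; apply: eq_bigr => i _; rewrite mxE scalerA.
have comb_cont : continuous (fun c => `|comb c|).
  move=> c; apply: (@continuous_comp _ _ _ comb (fun x => `|x|)).
    exact: combination_continuous.
  exact: norm_continuous.
have le_norm (c : 'rV[R]_dim) i : `|c ord0 i| <= `|c|.
  rewrite [leRHS]mx_normrE.
  exact: (le_bigmax _ (fun ij : 'I_1 * 'I_dim => `|c ij.1 ij.2|) (ord0, i)).
pose S := [set c : 'rV[R]_dim | `|c| = 1].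
have S_compact : compact S.
  apply: bounded_closed_compact.
    exists 1; split; first exact: num_real.
    by move=> y lt1y c /= ->; exact: ltW.
  rewrite (_ : S = (fun c : 'rV[R]_dim => `|c|) @^-1` [set 1]) //.
  apply: closed_comp => [c _|]; first exact: norm_continuous.
  exact: closed_eq.
have [[c0 S0]|S_empty] := pselect (S !=set0); last first.
  (* With at least one coordinate the sphere is nonempty. *)
  exists 1 => // v i; exfalso; apply: S_empty.
  have c_neq0 : const_mx 1 != 0 :> 'rV[R]_dim.
    apply/eqP => /matrixP/(_ ord0 i); rewrite !mxE => /eqP.
    by rewrite oner_eq0.
  exists (`|const_mx 1 : 'rV[R]_dim|^-1 *: const_mx 1); rewrite /S /=.
  by rewrite normrZ ger0_norm ?invr_ge0 // mulVf // normr_eq0.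
have [c1 Sc1 c1_min] : exists2 c, c \in S &
    forall t, t \in S -> `|comb c| <= `|comb t|.
  apply: compact_EVT_min => //; first by exists c0.
  exact: continuous_subspaceT.
have c1_gt0 : 0 < `|comb c1|.
  rewrite normr_gt0; apply/eqP => comb0.
  have c10 : c1 = 0.
    have basis_is_free := basis_free (vbasisP {: X}).
    apply/rowP => i; rewrite mxE -(coord_sum_free (c1 ord0) i basis_is_free).
    by rewrite -/(comb c1) comb0 linear0.
  by move: Sc1; rewrite inE /S /= c10 normr0 => /esym/eqP; rewrite oner_eq0.
exists `|comb c1|^-1; first by rewrite invr_gt0.
move=> v i; set c := \row_i coord basis i v.
have -> : coord basis i v = c ord0 i by rewrite mxE.
rewrite ler_pdivlMl //; have [c_eq0|c_neq0] := eqVneq c 0.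
  by rewrite c_eq0 mxE normr0 mulr0.
have nc_gt0 : 0 < `|c| by rewrite normr_gt0.
have := c1_min (`|c|^-1 *: c).
rewrite inE /S /= normrZ ger0_norm ?invr_ge0 // mulVf ?gt_eqF // => /(_ erefl).
rewrite combZ comb_coord normrZ ger0_norm ?invr_ge0 // ler_pdivlMl // => le_v.
by apply: le_trans le_v; rewrite mulrC; apply: ler_wpM2r.
Qed.

Lemma linear_form_bounded (g : {linear X -> R^o}) :
  exists2 B : R, 0 <= B & forall v, `|g v| <= B * `|v|.
Proof.
have [C C_gt0 coordC] := coord_bounded.
exists (\sum_(i < dim) C * `|g basis`_i|).
  by apply: sumr_ge0 => i _; rewrite mulr_ge0 // ltW.
move=> v; rewrite {1}(coord_fullv v) linear_sum mulr_suml.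
apply: le_trans (ler_norm_sum _ _ _) _; apply: ler_sum => i _.
rewrite linearZ normrM mulrAC.
by apply: ler_wpM2r => //; apply: coordC.
Qed.

Lemma linear_form_continuous (g : {linear X -> R^o}) : continuous g.
Proof.
apply/linear_bounded_continuous/linear_boundedP.
have [B _ gB] := linear_form_bounded g.
exists B; split => [|y lt_y v]; first exact: num_real.
by apply: le_trans (gB v) _; apply: ler_wpM2r => //; exact: ltW.
Qed.

End FiniteDimension.

(** * Dual norms and convex functions *)

Section DualNorm.
Variables (R : realType) (X : normedVectType R).
Implicit Types g h : 'Hom(X, R^o).

(** The two rules that replace the supremum in all later arguments are this
    one and [le_dual_norm]; the second needs the boundedness of linear forms. *)
Lemma dual_norm_le g (B : R) :
  (forall v, `|v| <= 1 -> g v <= B) -> dual_norm g <= B.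
Proof.
move=> gB; apply: ge_sup => [|_ [v v1 <-]]; last exact: gB.
by exists (g 0), 0; rewrite //= normr0.
Qed.

Lemma le_dual_norm g v : `|v| <= 1 -> g v <= dual_norm g.
Proof.
move=> v1; apply: ub_le_sup; last by exists v.
have [B B_ge0 gB] := linear_form_bounded g.
exists B => _ [u u1 <-]; apply: le_trans (ler_norm _) _.
by apply: le_trans (gB u) _; rewrite ler_piMr.
Qed.

Lemma dual_norm_ge0 g : 0 <= dual_norm g.
Proof. by rewrite -(linear0 g); apply: le_dual_norm; rewrite normr0. Qed.

Lemma dual_normD g h : dual_norm (g + h) <= dual_norm g + dual_norm h.
Proof.
apply: dual_norm_le => v v1; rewrite add_lfunE.
by apply: lerD; exact: le_dual_norm.
Qed.

Lemma dual_normN g : dual_norm (- g) <= dual_norm g.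
Proof.
apply: dual_norm_le => v v1; rewrite opp_lfunE -linearN.
by apply: le_dual_norm; rewrite normrN.
Qed.

Lemma dual_normB g h : dual_norm (g - h) <= dual_norm g + dual_norm h.
Proof. by apply: le_trans (dual_normD _ _) _; rewrite lerD2l dual_normN. Qed.

Lemma dual_normZ_le a g : 0 <= a -> dual_norm (a *: g) <= a * dual_norm g.
Proof.
move=> a_ge0; apply: dual_norm_le => v v1; rewrite scale_lfunE.
by apply: ler_wpM2l => //; exact: le_dual_norm.
Qed.

End DualNorm.

Section ConvexFunctions.
Variables (R : realType) (X : normedVectType R).

Lemma convex_function_le (D : set X) (f : X -> R) (a : R) (x y : X) :
  convex_function (D : set (convex_lmodType X)) f -> 0 <= a <= 1 -> D x -> D y ->
  f (a *: x + (1 - a) *: y) <= a * f x + (1 - a) * f y.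
Proof.
move=> f_convex /andP[a_ge0 a_le1] Dx Dy.
have := f_convex (Itv01 a_ge0 a_le1) x y.
by rewrite !inE => /(_ Dx Dy).
Qed.

Lemma convex_set_mem (D : set X) (a : R) (x y : X) :
  convex_set (D : set (convex_lmodType X)) -> 0 <= a <= 1 -> D x -> D y ->
  D (a *: x + (1 - a) *: y).
Proof.
move=> D_convex /andP[a_ge0 a_le1] Dx Dy.
have := D_convex x y (Itv01 a_ge0 a_le1).
by rewrite !inE => /(_ Dx Dy).
Qed.

Variables (l : X -> R).
Hypothesis l_convex : convex_function (setT : set (convex_lmodType X)) l.

Lemma convex_sum_le (n : nat) (u : 'I_n -> X) (B : R) : (0 < n)%N ->
  (forall i, l (u i) <= B) -> l (n%:R^-1 *: \sum_(i < n) u i) <= B.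
Proof.
elim: n u => // -[_ u _ uB|n IHn u _ uB].
  by rewrite big_ord1 invr1 scale1r.
rewrite big_ord_recl.
set S := \sum_(i < n.+1) _.
have n2_neq0 : n.+2%:R != 0 :> R by rewrite pnatr_eq0.
have n1_neq0 : n.+1%:R != 0 :> R by rewrite pnatr_eq0.
have n2_ge1 : 1 <= n.+2%:R :> R by rewrite ler1n.
have -> : n.+2%:R^-1 *: (u ord0 + S) =
    n.+2%:R^-1 *: u ord0 + (1 - n.+2%:R^-1) *: (n.+1%:R^-1 *: S).
  rewrite scalerDr scalerA; congr (_ + _ *: _).
  have n2E : n.+2%:R = 1 + n.+1%:R :> R by rewrite addrC natr1.
  by rewrite n2E in n2_neq0 *; field; apply/andP; split.
have a01 : 0 <= (n.+2%:R^-1 : R) <= 1.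
  by rewrite invr_ge0 ler0n invf_le1 // ltr0n.
apply: le_trans (convex_function_le l_convex a01 _ _) _ => //.
have -> : B = n.+2%:R^-1 * B + (1 - n.+2%:R^-1) * B by ring.
case/andP: a01 => a0 a1.
apply: lerD; apply: ler_wpM2l => //; first by rewrite subr_ge0.
by apply: IHn.
Qed.

(** With [n] basis vectors, a vector [v] is the average of the [n + 1] vectors
    [(n + 1) coord_i v *: b_i] and [0].  For bounded [v] each of the
    former lies between [- r b_i] and [r b_i] for a fixed [r], and there [l] is
    at most the larger of its two end values. *)
Lemma convex_bounded_above (C : R) :
  exists B : R, forall v : X, `|v| <= C -> l v <= B.
Proof.
have [D D_gt0 coordD] := coord_bounded X.
set n := \dim {: X}; set b := vbasis {: X}.
(* The extra point 0 keeps the average meaningful in dimension 0. *)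
pose m := n.+1.
pose r : R := m%:R * (D * (`|C| + 1)).
have r_gt0 : 0 < r by rewrite !mulr_gt0 // ?ltr0n // ltr_pwDr.
exists (`|l 0| + \sum_(i < n) (`|l (r *: b`_i)| + `|l (- (r *: b`_i))|)) => v vC.
set B := _ + _.
pose u (i : 'I_m) : X :=
  if unlift ord0 i is Some j then (m%:R * coord b j v) *: b`_j else 0.
have -> : v = m%:R^-1 *: \sum_(i < m) u i.
  rewrite big_ord_recl /u unlift_none add0r.
  under eq_bigr do rewrite liftK.
  rewrite scaler_sumr [LHS]coord_fullv; apply: eq_bigr => i _.
  by rewrite scalerA mulrA mulVf ?mul1r // pnatr_eq0.
have sum_ge0 (P : pred 'I_n) :
    0 <= \sum_(i < n | P i) (`|l (r *: b`_i)| + `|l (- (r *: b`_i))|).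
  by apply: sumr_ge0 => i _; rewrite addr_ge0.
apply: convex_sum_le => // i; rewrite /u.
case: unliftP => [j _|_]; last first.
  by apply: le_trans (ler_norm _) _; rewrite lerDl; exact: sum_ge0.
set q := m%:R * _.
have q_le : `|q| <= r.
  rewrite normrM normr_nat; apply: ler_wpM2l => //.
  apply: le_trans (coordD _ _) _; apply: ler_wpM2l; first exact: ltW.
  apply: le_trans vC _; apply: le_trans (ler_norm _) _; by rewrite lerDl.
pose a := (1 + q / r) / 2.
have a01 : 0 <= a <= 1.
  move: q_le; rewrite ler_norml => /andP[q_ge q_le].
  have : -1 <= q / r by rewrite ler_pdivlMr // mulN1r.
  have : q / r <= 1 by rewrite ler_pdivrMr // mul1r.
  by rewrite /a => *; apply/andP; split; lra.
have -> : q *: b`_j = a *: (r *: b`_j) + (1 - a) *: (- (r *: b`_j)).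
  rewrite scalerN -scalerBl scalerA; congr (_ *: _).
  by rewrite /a; field; rewrite gt_eqF.
apply: le_trans (convex_function_le l_convex a01 _ _) _ => //.
apply: (@le_trans _ _ (`|l (r *: b`_j)| + `|l (- (r *: b`_j))|)).
  case/andP: a01 => a0 a1.
  apply: lerD; apply: le_trans (ler_norm _) _; rewrite normrM.
    by rewrite ger0_norm // ler_piMl.
  by rewrite ger0_norm ?subr_ge0 // ler_piMl // gerBl.
by rewrite /B (bigD1 j) //= addrCA lerDl addr_ge0.
Qed.

(** A subgradient [g] at [z] satisfies [g v <= l (z + v) - l z].  The upper
    bound of [l] on a neighbourhood of [K] also bounds it below there, since
    [l z >= 2 l 0 - l (- z)]. *)
Lemma subgradient_bounded (K : set X) : compact K ->
  exists2 L : R, 0 < L & forall z g,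
    K z -> subdifferential l z g -> dual_norm g <= L.
Proof.
move=> /compact_bounded[C0 [_ /(_ (`|C0| + 1))]].
set C := `|C0| + 1 => KC.
have {}KC z : K z -> `|z| <= C.
  by move=> Kz; apply: KC => //; rewrite ltr_pwDr // ler_norm.
have [B lB] := convex_bounded_above (C + 1).
exists (`|B - 2 * l 0 + B| + 1) => [|z g Kz z_g]; first by rewrite ltr_pwDr.
apply: dual_norm_le => v v1.
apply: (@le_trans _ _ (B - 2 * l 0 + B)); last first.
  by apply: le_trans (ler_norm _) _; rewrite lerDl.
have : l z + g v <= l (z + v) by have := z_g (z + v); rewrite addrAC subrr add0r.
have : l (z + v) <= B.
  by apply: lB; apply: le_trans (ler_normD _ _) _; rewrite lerD // KC.
have : l (- z) <= B.
  by apply: lB; rewrite normrN; apply: le_trans (KC _ Kz) _; rewrite lerDl.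
have : l 0 <= 2^-1 * l z + (1 - 2^-1) * l (- z).
  have {1}-> : 0 = 2^-1 *: z + (1 - 2^-1) *: (- z) :> X.
    by rewrite scalerN -scalerBl (_ : _ - _ = 0) ?scale0r //; lra.
  by apply: (convex_function_le l_convex) => //; apply/andP; split; lra.
lra.
Qed.

End ConvexFunctions.

(** * Smooth functions and inequalities for sums of squares *)

Section Smoothness.
Variables (R : realType) (X : normedVectType R).

Lemma le0_of_le_small (a c : R) : (forall t, 0 < t -> a <= t * c) -> a <= 0.
Proof.
move=> ac; apply/ler_addgt0Pr => e e_gt0; rewrite add0r.
have c_gt0 : 0 < `|c| + 1 by rewrite ltr_pwDr.
apply: le_trans (ac (e / (`|c| + 1)) _) _; first exact: divr_gt0.
rewrite mulrAC ler_pdivrMr // ler_wpM2l //; first exact: ltW.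
by apply: le_trans (ler_norm _) _; rewrite lerDl.
Qed.

(** A subgradient of a differentiable function is its differential; comparing
    the two along [y + t *: v] for small [t] shows [g v <= 'd l y v], which is
    all that is needed since [v] may be replaced by [- v]. *)
Lemma smooth_subgradient_le (M : R) (l : X -> R) (y : X) (g : 'Hom(X, R^o)) :
  smooth M l -> subdifferential l y g ->
  forall x, l x <= l y + g (x - y) + M / 2 * `|x - y| ^+ 2.
Proof.
move=> [_ lM] y_g x.
have g_le v : g v <= 'd l y v.
  rewrite -subr_le0; apply: (@le0_of_le_small _ (M / 2 * `|v| ^+ 2)) => t t_gt0.
  have := le_trans (y_g (y + t *: v)) (lM (y + t *: v) y).
  rewrite addrAC subrr add0r !linearZ /= normrZ gtr0_norm // exprMn.
  rewrite -addrA lerD2l -lerBlDl => h.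
  rewrite -(ler_pM2l t_gt0); apply: le_trans (le_trans h _).
    by rewrite mulrBr.
  by rewrite -subr_ge0 (_ : _ - _ = 0) //; ring.
apply: le_trans (lM x y) _; rewrite lerD2r lerD2l.
by have := g_le (- (x - y)); rewrite !linearN /= lerN2.
Qed.

(** The function [l - gx] is minimal at [x].  Evaluating it at [y + s *: u] by
    smoothness shows that [s (gx - gy) u - M / 2 s^2] is at most the Bregman
    gap for all [s] and all [u] in the unit ball; choosing the best [s] gives
    the bound. *)
Lemma smooth_cocoercive (M : R) (l : X -> R) (x y : X) (gx gy : 'Hom(X, R^o)) :
  0 <= M -> smooth M l -> subdifferential l x gx -> subdifferential l y gy ->
  dual_norm (gx - gy) ^+ 2 <= 2 * M * (l y - l x - gx (y - x)).
Proof.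
move=> M_ge0 lM x_gx y_gy; set B := l y - l x - gx (y - x).
have parabola (s : R) (u : X) : `|u| <= 1 -> s * (gx - gy) u - M / 2 * s ^+ 2 <= B.
  move=> u1.
  have := le_trans (x_gx (y + s *: u)) (smooth_subgradient_le lM y_gy (y + s *: u)).
  rewrite [y + _ - y]addrAC subrr add0r [y + _ - x]addrAC linearD !linearZ /=.
  rewrite normrZ exprMn real_normK ?num_real // add_lfunE opp_lfunE /=.
  have : M / 2 * (s ^+ 2 * `|u| ^+ 2) <= M / 2 * s ^+ 2.
    apply: ler_wpM2l; first exact: divr_ge0.
    by rewrite ler_piMr ?sqr_ge0 // expr_le1.
  rewrite /B /GRing.scale /= mulrBr; lra.
have B_ge0 : 0 <= B.
  have := parabola 0 0; rewrite normr0 mul0r expr0n /= mulr0 subr0; exact.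
have MB_ge0 : 0 <= 2 * M * B by rewrite !mulr_ge0.
rewrite -[leRHS]sqr_sqrtr // ler_sqr ?nnegrE ?sqrtr_ge0 ?dual_norm_ge0 //.
apply: dual_norm_le => u u1; have [p_le0|p_gt0] := leP ((gx - gy) u) 0.
  exact: le_trans (sqrtr_ge0 _).
move: p_gt0 (fun s => parabola s u u1); move: ((gx - gy) u) => p p_gt0 parabola_p.
rewrite -[leLHS](ger0_norm (ltW p_gt0)) -sqrtr_sqr ler_wsqrtr //.
(* For M = 0 the parabola is a line, bounded above only if it is flat. *)
have [M_eq0|M_neq0] := eqVneq M 0.
  have := parabola_p ((B + 1) / p).
  by rewrite M_eq0 divfK ?gt_eqF // mul0r mul0r subr0; lra.
have M_gt0 : 0 < M by rewrite lt_def M_neq0.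
have := parabola_p (p / M).
have -> : p / M * p - M / 2 * (p / M) ^+ 2 = p ^+ 2 / (2 * M) by field.
by rewrite ler_pdivrMr ?mulr_gt0 // mulrC.
Qed.

End Smoothness.

Section RealSums.
Variable R : realType.

Lemma sqrtrD_le (a b : R) : 0 <= a -> 0 <= b ->
  Num.sqrt (a + b) <= Num.sqrt a + Num.sqrt b.
Proof.
move=> a_ge0 b_ge0.
rewrite -[leRHS]ger0_norm ?addr_ge0 ?sqrtr_ge0 // -sqrtr_sqr ler_wsqrtr //.
rewrite sqrrD !sqr_sqrtr // addrAC lerDl.
by rewrite mulrn_wge0 // mulr_ge0 // sqrtr_ge0.
Qed.

Lemma cauchy_schwarz2 (p q u v : R) : 0 <= p -> 0 <= q ->
  p * q + u * v <= Num.sqrt (p ^+ 2 + u ^+ 2) * Num.sqrt (q ^+ 2 + v ^+ 2).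
Proof.
move=> p_ge0 q_ge0; rewrite -sqrtrM ?addr_ge0 ?sqr_ge0 //.
apply: le_trans (ler_norm _) _; rewrite -sqrtr_sqr ler_wsqrtr //.
rewrite -subr_ge0 (_ : _ - _ = (p * v - q * u) ^+ 2) ?sqr_ge0 //; ring.
Qed.

Lemma minkowski2 (p q u v : R) : 0 <= p -> 0 <= q ->
  Num.sqrt ((p + q) ^+ 2 + (u + v) ^+ 2) <=
  Num.sqrt (p ^+ 2 + u ^+ 2) + Num.sqrt (q ^+ 2 + v ^+ 2).
Proof.
move=> p_ge0 q_ge0.
rewrite -[leRHS]ger0_norm ?addr_ge0 ?sqrtr_ge0 // -sqrtr_sqr ler_wsqrtr //.
rewrite [leRHS]sqrrD !sqr_sqrtr ?addr_ge0 ?sqr_ge0 //.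
rewrite -mulr_natl addrAC.
have -> : (p + q) ^+ 2 + (u + v) ^+ 2 =
    (p ^+ 2 + u ^+ 2) + (q ^+ 2 + v ^+ 2) + 2 * (p * q + u * v) by ring.
by rewrite lerD2l ler_pM2l //; exact: cauchy_schwarz2.
Qed.

Lemma minkowski_sum (n : nat) (u v : nat -> R) :
  Num.sqrt (\sum_(1 <= t < n.+1) (u t + v t) ^+ 2) <=
  Num.sqrt (\sum_(1 <= t < n.+1) u t ^+ 2) +
  Num.sqrt (\sum_(1 <= t < n.+1) v t ^+ 2).
Proof.
elim: n => [|n IHn]; first by rewrite !big_geq // sqrtr0 addr0.
rewrite !(big_nat_recr n.+1) //=.
have sum_ge0 (f : nat -> R) : 0 <= \sum_(1 <= t < n.+1) f t ^+ 2.
  by apply: sumr_ge0 => i _; exact: sqr_ge0.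
have := @minkowski2 (Num.sqrt (\sum_(1 <= t < n.+1) u t ^+ 2))
  (Num.sqrt (\sum_(1 <= t < n.+1) v t ^+ 2)) (u n.+1) (v n.+1)
  (sqrtr_ge0 _) (sqrtr_ge0 _).
rewrite (sqr_sqrtr (sum_ge0 u)) (sqr_sqrtr (sum_ge0 v)) => minkowski_last.
apply: le_trans minkowski_last.
apply: ler_wsqrtr.
rewrite lerD2r -[leLHS](sqr_sqrtr (sum_ge0 (fun t => u t + v t))).
by rewrite ler_sqr ?nnegrE ?addr_ge0 ?sqrtr_ge0.
Qed.

(** By [(u + v)^2 <= 3 u^2 + 3/2 v^2], the term [e_t^2] receives at most
    [3 t^2 + 3/2 (t + 1)^2], which is below [7 t^2] for [t >= 2]; for [t = 1]
    the term [e_0] vanishes and the coefficient is exactly [1 + 6 = 7].  That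
    7 is smaller than 8 leaves the room needed in
    [variation_bounded_gradient]. *)
Lemma consecutive_weighted_sum_le (n : nat) (e : nat -> R) : (0 < n)%N -> e 0%N = 0 ->
  \sum_(1 <= t < n.+1) (weight t * (e t + e t.-1)) ^+ 2 <=
  7 * \sum_(1 <= t < n.+1) (weight t * e t) ^+ 2.
Proof.
move=> n_gt0 e0.
have tail_ge0 : 0 <= 3 / 2 * (weight n.+1 * e n) ^+ 2 :> R.
  by rewrite mulr_ge0 ?sqr_ge0 //; lra.
(* The induction carries the share of e n that is due in the next round. *)
suff : \sum_(1 <= t < n.+1) (weight t * (e t + e t.-1)) ^+ 2 +
    3 / 2 * (weight n.+1 * e n) ^+ 2 <=
    7 * \sum_(1 <= t < n.+1) (weight t * e t) ^+ 2 by lra.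
elim: n n_gt0 {tail_ge0} => // -[_ _|n IHn _].
  by rewrite !big_nat1 /= e0 /weight; nra.
rewrite big_nat_recr //= [in leRHS]big_nat_recr //= mulrDr.
apply: (@le_trans _ _ (7 * (\sum_(1 <= t < n.+2) (weight t * e t) ^+ 2) -
  3 / 2 * (weight n.+2 * e n.+1) ^+ 2 +
  (weight n.+2 * (e n.+2 + e n.+1)) ^+ 2 + 3 / 2 * (weight n.+3 * e n.+2) ^+ 2)).
  by have := IHn erefl; lra.
have young (a b : R) : (a + b) ^+ 2 <= 3 * a ^+ 2 + 3 / 2 * b ^+ 2.
  by have := sqr_ge0 (2 * a - b); lra.
have := young (weight n.+2 * e n.+2) (weight n.+2 * e n.+1); rewrite -mulrDr.
have : 3 / 2 * (weight n.+3 * e n.+2) ^+ 2 <= 4 * (weight n.+2 * e n.+2) ^+ 2.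
  rewrite !exprMn mulrA [leRHS]mulrA; apply: ler_wpM2r; first exact: sqr_ge0.
  rewrite /weight -[n.+3%:R]natr1 -[n.+2%:R]natr1 -[n.+1%:R]natr1.
  have : 0 <= n%:R :> R by []; nra.
lra.
Qed.

End RealSums.

(** * Averaged iterates *)

Section AveragedIterates.
Variables (R : realType) (X : normedVectType R).

Lemma cumweight0 : cumweight 0 = 0 :> R.
Proof. by rewrite /cumweight big_geq. Qed.

Lemma cumweightS t : cumweight t.+1 = cumweight t + weight t.+1 :> R.
Proof. by rewrite /cumweight big_nat_recr. Qed.

Lemma weight_ge0 t : 0 <= weight t :> R.
Proof. exact: ler0n. Qed.

Lemma cumweight_ge0 t : 0 <= cumweight t :> R.
Proof. by apply: sumr_ge0 => s _; exact: weight_ge0. Qed.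

Lemma cumweight_gt0 t : (0 < t)%N -> 0 < cumweight t :> R.
Proof.
by case: t => // t _; rewrite cumweightS ltr_wpDl ?cumweight_ge0 // ltr0n.
Qed.

Lemma cumweightE t : cumweight t = t%:R * t.+1%:R / 2 :> R.
Proof.
elim: t => [|t IHt]; first by rewrite cumweight0 !mul0r.
by rewrite cumweightS IHt /weight -[t.+2%:R]natr1 -[t.+1%:R]natr1; field.
Qed.

(** The comparison of step sizes behind acceleration: it lets the Bregman gaps,
    weighted by [cumweight t], pay for the squared drift of the gradients. *)
Lemma weight_sqr_le t : (0 < t)%N -> weight t.+1 ^+ 2 <= 4 * cumweight t :> R.
Proof.
move=> t_gt0; rewrite cumweightE /weight -[t.+1%:R]natr1.
have : 1 <= t%:R :> R by rewrite ler1n.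
nra.
Qed.

Lemma ratio_itv t : 0 <= (weight t.+1 / cumweight t.+1 : R) <= 1.
Proof.
rewrite divr_ge0 ?weight_ge0 ?cumweight_ge0 //=.
by rewrite ler_pdivrMr ?cumweight_gt0 // mul1r cumweightS lerDr cumweight_ge0.
Qed.

Lemma ratio_mul t :
  cumweight t.+1 * (weight t.+1 / cumweight t.+1) = weight t.+1 :> R.
Proof. by rewrite mulrC divfK // gt_eqF // cumweight_gt0. Qed.

Lemma ratio_compl t :
  cumweight t.+1 * (1 - weight t.+1 / cumweight t.+1) = cumweight t :> R.
Proof. by rewrite mulrBr ratio_mul mulr1 cumweightS addrK. Qed.

Lemma averaged1 (x : nat -> X) : averaged x 1 = x 1%N.
Proof.
by rewrite /= /cumweight big_nat1 divff ?oner_neq0 // scale1r subrr scale0r addr0.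
Qed.

Lemma averagedS (x : nat -> X) t :
  cumweight t.+1 *: averaged x t.+1 =
  weight t.+1 *: x t.+1 + cumweight t *: averaged x t.
Proof. by rewrite /= scalerDr !scalerA ratio_mul ratio_compl. Qed.

Variables (K : set X) (x : nat -> X).
Hypothesis K_convex : convex_set (K : set (convex_lmodType X)).

Lemma averaged_mem t : (0 < t)%N -> (forall s, (1 <= s <= t)%N -> K (x s)) ->
  K (averaged x t).
Proof.
elim: t => // -[_ _ Kx|t IHt _ Kx]; first by rewrite averaged1; exact: Kx.
apply: (convex_set_mem K_convex (ratio_itv _)); first by apply: Kx; rewrite /= leqnn.
by apply: IHt => // s /andP[s_ge1 s_le]; apply: Kx; rewrite s_ge1 leqW.
Qed.

Lemma averaged_convex_le (r : X -> R) t :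
  convex_function (K : set (convex_lmodType X)) r -> (0 < t)%N ->
  (forall s, (1 <= s <= t)%N -> K (x s)) ->
  cumweight t * r (averaged x t) <= \sum_(1 <= s < t.+1) weight s * r (x s).
Proof.
move=> r_convex; elim: t => // -[_ _ Kx|t IHt _ Kx].
  by rewrite averaged1 big_nat1 cumweightS cumweight0 add0r.
have Kx' s : (1 <= s <= t.+1)%N -> K (x s).
  by move=> /andP[s_ge1 s_le]; apply: Kx; rewrite s_ge1 leqW.
have Kx_last : K (x t.+2) by apply: Kx; rewrite /= leqnn.
have := ler_wpM2l (cumweight_ge0 t.+2)
  (convex_function_le r_convex (ratio_itv t.+1) Kx_last (averaged_mem (ltn0Sn t) Kx')).
rewrite mulrDr 2![cumweight t.+2 * (_ * r _)]mulrA ratio_mul ratio_compl => h.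
rewrite (big_nat_recr t.+2) //= addrC.
by apply: le_trans h _; rewrite lerD2l; exact: IHt.
Qed.

(** Anytime online-to-batch conversion: [averagedS] turns
    [a_t (z_t - u)] into [a_t (x_t - u) + A (t-1) (z_(t-1) - z_t)], and the last
    term is what the Bregman gap accounts for exactly. *)
Lemma anytime_bound (l : X -> R) (G : nat -> 'Hom(X, R^o)) (u : X) T
    (z := averaged x) :
  (forall t, (1 <= t <= T)%N -> subdifferential l (z t) (G t)) ->
  cumweight T * (l (z T) - l u) +
    \sum_(1 <= t < T.+1)
      cumweight t.-1 * (l (z t.-1) - l (z t) - G t (z t.-1 - z t))
  <= \sum_(1 <= t < T.+1) weight t * G t (x t - u).
Proof.
elim: T => [_|t IHt z_G]; first by rewrite !big_geq // cumweight0 mul0r addr0.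
rewrite !(big_nat_recr t.+1) //=.
have /IHt {}IHt : forall s, (1 <= s <= t)%N -> subdifferential l (z s) (G s).
  by move=> s /andP[s_ge1 s_le]; apply: z_G; rewrite s_ge1 leqW.
have z_G1 : l (z t.+1) + G t.+1 (u - z t.+1) <= l u.
  by apply: z_G; rewrite /= leqnn.
have regroup (y y' : X) :
    cumweight t.+1 *: y' = weight t.+1 *: x t.+1 + cumweight t *: y ->
    weight t.+1 * G t.+1 (y' - u) =
    weight t.+1 * G t.+1 (x t.+1 - u) + cumweight t * G t.+1 (y - y').
  move=> /(congr1 (G t.+1)); rewrite linearD !linearZ => Gy'.
  have {}Gy' : cumweight t.+1 * G t.+1 y' =
    weight t.+1 * G t.+1 (x t.+1) + cumweight t * G t.+1 y by [].
  have GB a b : G t.+1 (a - b) = G t.+1 a - G t.+1 b by rewrite linearB.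
  by rewrite !GB; move: Gy'; rewrite cumweightS; lra.
have := ler_wpM2l (weight_ge0 t.+1) z_G1.
rewrite -[u - _]opprB linearN mulrDr mulrN (regroup _ _ (averagedS x t)) cumweightS.
move: IHt; rewrite -/z; lra.
Qed.

End AveragedIterates.

(** * Pathwise bounds *)

Section GradientVariation.
Variables (R : realType) (X : normedVectType R).
Variables (g G : nat -> 'Hom(X, R^o)) (T : nat).
Hypotheses (T_gt0 : (0 < T)%N) (g0 : g 0%N = 0) (G0 : G 0%N = 0).

Local Notation dev t := (dual_norm (g t - G t)).
Local Notation drift t := (dual_norm (G t - G t.-1)).
Local Notation variation :=
  (\sum_(1 <= t < T.+1) dual_norm (weight t *: (g t - g t.-1)) ^+ 2).

Lemma variation_le : variation <=
  \sum_(1 <= t < T.+1)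
    (weight t * (dev t + dev t.-1) + weight t * drift t) ^+ 2.
Proof.
apply: ler_sum => t _; rewrite -mulrDr ler_sqr ?nnegrE ?dual_norm_ge0 //; last first.
  by rewrite mulr_ge0 ?weight_ge0 // !addr_ge0 ?dual_norm_ge0.
apply: le_trans (dual_normZ_le _ (weight_ge0 _ _)) _.
apply: ler_wpM2l; first exact: weight_ge0.
have -> : g t - g t.-1 = (g t - G t) - (g t.-1 - G t.-1) + (G t - G t.-1).
  by rewrite opprB [RHS]addrAC !subrKA.
apply: le_trans (dual_normD _ _) _; rewrite lerD2r.
exact: dual_normB.
Qed.

Lemma deviation_sum_le :
  \sum_(1 <= t < T.+1) (weight t * (dev t + dev t.-1)) ^+ 2 <=
  7 * \sum_(1 <= t < T.+1) weight t ^+ 2 * dev t ^+ 2.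
Proof.
under [X in _ <= 7 * X]eq_bigr do rewrite -exprMn.
apply: (@consecutive_weighted_sum_le R T (fun t => dev t)) => //.
rewrite g0 G0 subr0; apply/le_anti/andP; split; last exact: dual_norm_ge0.
by apply: dual_norm_le => v _; rewrite lfunE.
Qed.

(** The constants come from
    [(a + b)^2 <= 8/7 a^2 + 8 b^2], with [b = a_t * 2 L]; the deviations get
    [8/7 * 7 = 8] and the drift [8 * (2 L)^2]. *)
Lemma variation_bounded_gradient (L : R) :
  (forall t, (t <= T)%N -> dual_norm (G t) <= L) ->
  variation <= 8 * \sum_(1 <= t < T.+1) weight t ^+ 2 * (dev t ^+ 2 + (2 * L) ^+ 2).
Proof.
move=> GL; apply: le_trans variation_le _.
have young (a b : R) : (a + b) ^+ 2 <= 8 / 7 * a ^+ 2 + 8 * b ^+ 2.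
  by have := sqr_ge0 (a - 7 * b); lra.
apply: (@le_trans _ _ (8 / 7 * \sum_(1 <= t < T.+1)
    (weight t * (dev t + dev t.-1)) ^+ 2 +
    8 * \sum_(1 <= t < T.+1) weight t ^+ 2 * (2 * L) ^+ 2)).
  rewrite !mulr_sumr -big_split /= big_nat_cond [leRHS]big_nat_cond.
  apply: ler_sum => t /andP[/andP[_ t_le] _].
  apply: le_trans (young _ _) _; rewrite lerD2l; apply: ler_wpM2l => //.
  rewrite exprMn; apply: ler_wpM2l; first exact: sqr_ge0.
  have drift_le : drift t <= 2 * L.
    apply: le_trans (dual_normB _ _) _.
    by rewrite mulr_natl mulr2n lerD // GL // (leq_trans (leq_pred _)).
  rewrite ler_sqr ?nnegrE ?dual_norm_ge0 //.
  exact: le_trans (dual_norm_ge0 _) drift_le.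
under [X in _ <= 8 * X]eq_bigr do rewrite mulrDr.
rewrite big_split /= mulrDr lerD2r.
have := deviation_sum_le; lra.
Qed.

(** Minkowski's inequality keeps the coefficient of the drift equal to 1, as
    the constant [2 M c2^2] of the smooth case requires. *)
Lemma variation_drift (S : R) :
  \sum_(1 <= t < T.+1) (weight t * drift t) ^+ 2 <= S ->
  Num.sqrt variation <=
  Num.sqrt (8 * \sum_(1 <= t < T.+1) weight t ^+ 2 * dev t ^+ 2) + Num.sqrt S.
Proof.
move=> drift_le; apply: le_trans (ler_wsqrtr variation_le) _.
apply: le_trans (minkowski_sum _ _ _) _; apply: lerD; apply: ler_wsqrtr => //.
apply: le_trans deviation_sum_le _; apply: ler_wpM2r; last by rewrite ler_nat.
by apply: sumr_ge0 => t _; rewrite mulr_ge0 ?sqr_ge0.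
Qed.

End GradientVariation.

Section PathwiseBound.
Variables (R : realType) (X : normedVectType R) (K : set X) (l r : X -> R).
Variables (x : nat -> X) (g G : nat -> 'Hom(X, R^o)) (T : nat) (u : X).
Variables (c1 c2 L : R).
Hypothesis K_convex : convex_set (K : set (convex_lmodType X)).
Hypothesis r_convex : convex_function (K : set (convex_lmodType X)) r.
Hypotheses (T_gt0 : (0 < T)%N) (g0 : g 0%N = 0) (G0 : G 0%N = 0).
Hypothesis Kx : forall t, (1 <= t <= T)%N -> K (x t).
Let z := averaged x.
Hypothesis z_G : forall t, (1 <= t <= T)%N -> subdifferential l (z t) (G t).
Hypothesis c2_ge0 : 0 <= c2.
Hypothesis GL : forall t, (t <= T)%N -> dual_norm (G t) <= L.
Hypothesis regret :
  \sum_(1 <= t < T.+1) weight t * (g t (x t - u) + r (x t) - r u) <=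
  c1 + c2 * Num.sqrt (\sum_(1 <= t < T.+1)
    dual_norm (weight t *: (g t - g t.-1)) ^+ 2).

Local Notation bregman t := (l (z t.-1) - l (z t) - G t (z t.-1 - z t)).
Let D := \sum_(1 <= t < T.+1) cumweight t.-1 * bregman t.
Let noise := \sum_(1 <= t < T.+1) weight t * (G t - g t) (x t - u).

Lemma bregman_ge0 t : (1 <= t <= T)%N -> 0 <= bregman t.
Proof. by move=> t_itv; have := z_G t_itv (z t.-1); lra. Qed.

Lemma bregman_sum_ge0 : 0 <= D.
Proof.
rewrite /D big_nat_cond; apply: sumr_ge0 => t /andP[t_itv _].
by rewrite mulr_ge0 ?cumweight_ge0 // bregman_ge0.
Qed.

Lemma pathwise_regret :
  cumweight T * (l (z T) + r (z T) - (l u + r u)) <=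
  c1 + c2 * Num.sqrt (\sum_(1 <= t < T.+1)
    dual_norm (weight t *: (g t - g t.-1)) ^+ 2) - D + noise.
Proof.
have l_le := anytime_bound u z_G.
have r_le := averaged_convex_le K_convex r_convex T_gt0 Kx.
have sumE : \sum_(1 <= t < T.+1) weight t * (g t (x t - u) + r (x t) - r u) =
    \sum_(1 <= t < T.+1) weight t * G t (x t - u) - noise +
    (\sum_(1 <= t < T.+1) weight t * r (x t) - cumweight T * r u).
  rewrite /noise /cumweight mulr_suml -!sumrB -big_split /=.
  by apply: eq_bigr => t _; rewrite add_lfunE opp_lfunE; ring.
move: regret l_le r_le; rewrite sumE -/D -/z !(mulrBr, mulrDr); lra.
Qed.

Lemma pathwise_lipschitz :
  cumweight T * (l (z T) + r (z T) - (l u + r u)) <=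
  c1 + c2 * Num.sqrt (8 * \sum_(1 <= t < T.+1)
    weight t ^+ 2 * (dual_norm (g t - G t) ^+ 2 + (2 * L) ^+ 2)) + noise.
Proof.
apply: le_trans pathwise_regret _; rewrite lerD2r.
rewrite lerBlDr; apply: ler_wpDr; first exact: bregman_sum_ge0.
rewrite lerD2l; apply: ler_wpM2l => //; apply: ler_wsqrtr.
exact: variation_bounded_gradient.
Qed.

(** The first round has no Bregman gap to rely on ([cumweight 0 = 0]) and
    contributes [L^2]. *)
Lemma drift_sum_le (M : R) : 0 <= M -> smooth M l ->
  \sum_(1 <= t < T.+1) (weight t * dual_norm (G t - G t.-1)) ^+ 2 <=
  L ^+ 2 + 8 * M * D.
Proof.
move=> M_ge0 lM; rewrite /D !(@big_ltn _ _ _ 1) //= cumweight0 mul0r add0r.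
apply: lerD.
  rewrite G0 subr0 /weight mul1r ler_sqr ?nnegrE ?dual_norm_ge0 ?GL //.
  by apply: le_trans (GL (leq0n T)); exact: dual_norm_ge0.
rewrite mulr_sumr big_nat_cond [leRHS]big_nat_cond.
apply: ler_sum => -[//|t] /andP[/andP[t_ge2 t_le] _] /=.
have t_itv : (1 <= t.+1 <= T)%N by [].
have t_itv' : (1 <= t <= T)%N by rewrite -ltnS t_ge2 ltnW.
rewrite exprMn.
have cocoercive := smooth_cocoercive M_ge0 lM (z_G t_itv) (z_G t_itv').
apply: le_trans (ler_pM (sqr_ge0 _) (sqr_ge0 _) (weight_sqr_le R _) cocoercive) _.
  by case/andP: t_itv'.
by rewrite le_eqVlt; apply/orP; left; apply/eqP; rewrite /=; ring.
Qed.

(** The drift costs [c2 sqrt (8 M D)], at most [2 M c2^2 + D] by the inequality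
    of arithmetic and geometric means; [D] is the gain of [pathwise_regret]. *)
Lemma pathwise_smooth (M : R) : 0 <= M -> smooth M l ->
  cumweight T * (l (z T) + r (z T) - (l u + r u)) <=
  c1 + Num.sqrt 2 * c2 * (2 * L) + 2 * M * c2 ^+ 2 +
  c2 * Num.sqrt (8 * \sum_(1 <= t < T.+1)
    weight t ^+ 2 * dual_norm (g t - G t) ^+ 2) + noise.
Proof.
move=> M_ge0 lM; apply: le_trans pathwise_regret _; rewrite lerD2r.
have D_ge0 := bregman_sum_ge0.
have MD_ge0 : 0 <= 8 * M * D by rewrite !mulr_ge0.
have L_ge0 : 0 <= L := le_trans (dual_norm_ge0 _) (GL (leq0n T)).
have := ler_wpM2l c2_ge0 (variation_drift T_gt0 g0 G0 (drift_sum_le M_ge0 lM)).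
have := ler_wpM2l c2_ge0 (sqrtrD_le (sqr_ge0 L) MD_ge0).
rewrite sqrtr_sqr ger0_norm //.
have : c2 * Num.sqrt (8 * M * D) <= 2 * M * c2 ^+ 2 + D.
  rewrite -{1}(ger0_norm c2_ge0) -sqrtr_sqr -sqrtrM ?sqr_ge0 //.
  have rhs_ge0 : 0 <= 2 * M * c2 ^+ 2 + D.
    by rewrite addr_ge0 // mulr_ge0 ?sqr_ge0 // mulr_ge0.
  rewrite -[leRHS]ger0_norm // -sqrtr_sqr ler_wsqrtr //.
  by have := sqr_ge0 (2 * M * c2 ^+ 2 - D); lra.
have : c2 * L <= Num.sqrt 2 * c2 * (2 * L).
  have sqrt2_ge1 : 1 <= Num.sqrt 2 :> R.
    by rewrite -[leLHS]sqrtr1 ler_wsqrtr // ler1n.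
  have : 0 <= c2 * L by rewrite mulr_ge0.
  nra.
rewrite !mulrDr; lra.
Qed.

End PathwiseBound.

(** * Expectations of pathwise bounds *)

Section LowerIntegral.
Context d (T : measurableType d) (R : realType).
Variable mu : {measure set T -> \bar R}.
Local Open Scope ereal_scope.

(** The integral of a nonnegative function is a supremum over the simple
    functions below it, so it is monotone without measurability. *)
Lemma ge0_le_integral_lower (f g : T -> \bar R) :
  (forall x, 0 <= f x) -> (forall x, f x <= g x) ->
  \int[mu]_x f x <= \int[mu]_x g x.
Proof.
move=> f_ge0 fg; have g_ge0 x : 0 <= g x := le_trans (f_ge0 x) (fg x).
rewrite !ge0_integralTE //; apply: le_ereal_sup => _ [k k_le <-].
by exists k => // x; apply: le_trans (k_le x) (fg x).
Qed.

(** The upper bound is changed on the exceptional null set, to [+oo] for its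
    positive part and to [0] for its negative part, so that the comparison
    holds everywhere. *)
Lemma ae_le_integral_lower (h U : T -> R) :
  mu.-integrable setT (EFin \o U) -> {ae mu, forall x, (h x <= U x)%R} ->
  \int[mu]_x (h x)%:E <= \int[mu]_x (U x)%:E.
Proof.
move=> /measurable_int mU [N [mN muN hU]].
have {}hU x : ~ N x -> (h x <= U x)%R.
  by move=> Nx; apply: contrapT => hUx; apply: Nx; exact: hU.
have mUp := measurable_funepos mU; have mUn := measurable_funeneg mU.
rewrite [leLHS]integralE [leRHS]integralE; apply: leeB.
  pose V := ((EFin \o U)^\+ \+ (cst +oo) \_ N).
  rewrite [leRHS](ae_eq_integral V) //; last 2 first.
  - apply: emeasurable_funD => //; apply/(measurable_restrictT _ _).1 => //.
  - exists N; split => // x /=; apply: contra_notP => Nx _.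
    by rewrite /V /= patchE ifN ?adde0 // notin_setE.
  apply: ge0_le_integral_lower => x; first exact: funepos_ge0.
  rewrite /V /= patchE; case: ifPn => [_|].
    by rewrite addey ?leey // gt_eqF // (lt_le_trans _ (funepos_ge0 _ _)).
  rewrite notin_setE => /hU hUx; rewrite adde0 !funeposE /=.
  by rewrite ge_max le_max lee_fin hUx /= le_max lexx orbT.
pose V := ((EFin \o U)^\- \_ (~` N)).
rewrite [leLHS](ae_eq_integral V) //; last 2 first.
- apply/(measurable_restrictT _ _).1; first exact: measurableC.
  exact: measurable_funS mUn.
- exists N; split => // x /=; apply: contra_notP => Nx _.
  by rewrite /V patchE ifT // inE.
apply: ge0_le_integral_lower => x.
  by rewrite /V patchE; case: ifP => // _; exact: funeneg_ge0.
rewrite /V patchE; case: ifPn => [|_]; last exact: funeneg_ge0.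
rewrite inE => /hU hUx; rewrite !funenegE /=.
by rewrite ge_max le_max lee_fin lerN2 hUx /= le_max lexx orbT.
Qed.

End LowerIntegral.

Section SquareRootExpectation.
Context d (T : measurableType d) (R : realType).
Variable P : probability T R.

Lemma integral_affine (N V : T -> R) (n v k p q : R) :
  P.-integrable setT (EFin \o N) -> P.-integrable setT (EFin \o V) ->
  (\int[P]_w (N w)%:E = n%:E)%E -> (\int[P]_w (V w)%:E = v%:E)%E ->
  P.-integrable setT (EFin \o (fun w => k + p * N w + q * V w)) /\
  (\int[P]_w (k + p * N w + q * V w)%:E = (k + p * n + q * v)%:E)%E.
Proof.
move=> iN iV intN intV.
have ik : P.-integrable setT (EFin \o cst k).
  by apply: finite_measure_integrable_cst.
have ipN : P.-integrable setT (EFin \o (fun w => p * N w)).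
  exact: (integrableZl measurableT p iN).
have iqV : P.-integrable setT (EFin \o (fun w => q * V w)).
  exact: (integrableZl measurableT q iV).
have ikpN : P.-integrable setT (EFin \o (fun w => k + p * N w)).
  exact: (integrableD measurableT ik ipN).
split; first exact: (integrableD measurableT ikpN iqV).
rewrite (integralD_EFin measurableT ikpN iqV) (integralD_EFin measurableT ik ipN).
rewrite !EFinD !EFinM -intN -intV; congr (_ + _ + _)%E.
    by have := expectation_cst P k; rewrite unlock.
  exact: (integralZl measurableT iN).
exact: (integralZl measurableT iV).
Qed.

(** Jensen's inequality for the square root, in the tangent form
    [sqrt N <= N / (2 s) + s / 2].  The optimal [s = sqrt n] may be [0], hence the
    small positive shift. *)
Lemma expectation_sqrt_le (h N V : T -> R) (a C c n : R) : 0 < a -> 0 <= c ->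
  P.-integrable setT (EFin \o N) -> P.-integrable setT (EFin \o V) ->
  (forall w, 0 <= N w) ->
  (\int[P]_w (N w)%:E = n%:E)%E -> (\int[P]_w (V w)%:E = 0)%E ->
  {ae P, forall w, a * h w <= C + c * Num.sqrt (N w) + V w} ->
  ('E_P[h] <= ((C + c * Num.sqrt n) / a)%:E)%E.
Proof.
move=> a_gt0 c_ge0 iN iV N_ge0 intN intV h_le.
have n_ge0 : 0 <= n.
  by rewrite -lee_fin -intN; apply: integral_ge0 => w _; rewrite lee_fin.
apply/lee_addgt0Pr => e e_gt0.
pose s := Num.sqrt n + e * a / (c + 1).
have ea_gt0 : 0 < e * a / (c + 1) by rewrite divr_gt0 ?mulr_gt0 // ltr_wpDl.
have s_gt0 : 0 < s by rewrite ltr_wpDl ?sqrtr_ge0.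
have [iU intU] := integral_affine (a^-1 * (C + c * (s / 2))) (a^-1 * (c / (2 * s)))
  a^-1 iN iV intN intV.
rewrite unlock; apply: (@le_trans _ _ _ _ _ (ae_le_integral_lower iU _)); last first.
  have a_neq0 : a != 0 by rewrite gt_eqF.
  rewrite intU -EFinD lee_fin mulr0 addr0 -mulrA -mulrDr ler_pdivrMl //.
  rewrite [a * (_ + _)]mulrDr [a * (_ / _)]mulrC divfK //.
  have half : n / (2 * s) <= Num.sqrt n / 2.
    rewrite ler_pdivrMr ?mulr_gt0 // -{1}(sqr_sqrtr n_ge0) /s.
    have := mulr_ge0 (sqrtr_ge0 n) (ltW ea_gt0); lra.
  have ce_le : c * (e * a / (c + 1)) <= e * a.
    rewrite mulrA ler_pdivrMr ?ltr_wpDl // mulrC ler_pM2l ?mulr_gt0 //.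
    by rewrite lerDl.
  have cea_ge0 : 0 <= c * (e * a / (c + 1)) by rewrite mulr_ge0 // ltW.
  have := ler_wpM2l c_ge0 half.
  have -> : c / (2 * s) * n = c * (n / (2 * s)) by rewrite mulrAC mulrA.
  by rewrite /s [a * e]mulrC; lra.
move: h_le; apply: filterS => w.
have sqrtN_le : Num.sqrt (N w) <= N w / (2 * s) + s / 2.
  have -> : N w / (2 * s) + s / 2 = (N w + s ^+ 2) / (2 * s).
    by field; rewrite gt_eqF.
  rewrite ler_pdivlMr ?mulr_gt0 // -{2}(sqr_sqrtr (N_ge0 w)).
  by have := sqr_ge0 (Num.sqrt (N w) - s); lra.
have := ler_wpM2l c_ge0 sqrtN_le => csqrt h_le.
rewrite -mulrA -!mulrDr ler_pdivlMl //; apply: le_trans h_le _.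
rewrite lerD2r -addrA lerD2l; apply: le_trans csqrt _.
by rewrite le_eqVlt; apply/orP; left; apply/eqP; field; rewrite gt_eqF.
Qed.

End SquareRootExpectation.

(** * Pulling known factors out of conditional expectations *)

Section PullOut.
Context d (T : measurableType d) (R : realType).
Variable P : probability T R.
Variable F : set (set T).
Hypotheses (F_sigma : sigma_algebra setT F) (F_measurable : F `<=` measurable).

Lemma sigma_algebra_setI : setI_closed F.
Proof.
by have /(sigma_algebraP (fun A _ => @subsetT _ A))[] := F_sigma.
Qed.

Lemma sigma_algebra_setT : F setT.
Proof.
by have /(sigma_algebraP (fun A _ => @subsetT _ A))[] := F_sigma.
Qed.

Lemma sigma_algebra_setC A : F A -> F (~` A).
Proof. by case: F_sigma => _ FC _ FA; rewrite -setTD; exact: FC. Qed.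

Variables (h W : T -> R) (C : R).
Hypothesis h_F : forall a, F [set w | h w < a].
Hypothesis h_le : forall w, `|h w| <= C.
Hypothesis W_int : P.-integrable setT (EFin \o W).
Hypothesis W_mean : forall B, F B -> \int[P]_(w in B) W w = 0.

Let h_measurable : measurable_fun setT h.
Proof.
apply: (measurability _ (RGenInftyO.measurableE R)) => _ [_ [a ->] <-].
rewrite setTI; apply: F_measurable.
by rewrite (_ : h @^-1` _ = [set w | h w < a]) // predeqE => w /=; rewrite in_itv.
Qed.

Lemma integrable_pull_out : P.-integrable setT (EFin \o (fun w => h w * W w)).
Proof.
have := integrableMr measurableT h_measurable _ W_int; apply.
by exists C; split => [|y C_lt w _]; [exact: num_real|exact: le_trans (ltW C_lt)].
Qed.

Let integrable_on B (f : T -> R) : F B ->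
  P.-integrable setT (EFin \o f) -> P.-integrable B (EFin \o f).
Proof. by move=> FB; apply: integrableS => //; exact: F_measurable. Qed.

Let integrable_norm : P.-integrable setT (EFin \o (fun w => `|W w|)).
Proof. exact: (integrable_abse W_int). Qed.

Let split_integral B m (f : T -> R) : F B -> P.-integrable setT (EFin \o f) ->
  \int[P]_(w in B) f w =
  \int[P]_(w in B `&` [set w | h w < m]) f w +
  \int[P]_(w in B `&` ~` [set w | h w < m]) f w.
Proof.
move=> FB f_int; rewrite -Rintegral_setU.
- by rewrite -setIUr setUCr setIT.
- by apply: F_measurable; exact: sigma_algebra_setI.
- by apply: F_measurable; apply: sigma_algebra_setI => //; exact: sigma_algebra_setC.
- by rewrite -setIUr setUCr setIT; exact: integrable_on.
- by apply/disj_setPS => w [[_ lt] [_]].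
Qed.

(** Where [a <= h <= b], replacing [h] by the constant [a] costs at most
    [b - a] times the integral of [|W|], and the constant contributes nothing
    since [W] has mean zero on [B].  Cutting [B] along the level [(a + b) / 2]
    of [h] halves the error. *)
Lemma bisection n B a b : F B -> (forall w, B w -> a <= h w <= b) ->
  `|\int[P]_(w in B) (h w * W w)| <=
  (b - a) / 2 ^+ n * \int[P]_(w in B) `|W w|.
Proof.
elim: n B a b => [|n IHn] B a b FB h_ab.
  have mB := F_measurable FB.
  have WB := integrable_on FB W_int.
  have aWB : P.-integrable B (EFin \o (fun w => a * W w)).
    exact: (integrableZl mB a WB).
  have hWB := integrable_on FB integrable_pull_out.
  have -> : \int[P]_(w in B) (h w * W w) = \int[P]_(w in B) (h w * W w - a * W w).
    by rewrite RintegralB // RintegralZl // W_mean // mulr0 subr0.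
  have dWB := integrableB mB hWB aWB.
  apply: le_trans (le_normr_Rintegral mB dWB) _.
  rewrite expr0 divr1 -RintegralZl //; last exact: integrable_on.
  apply: le_Rintegral => //.
  - exact: (integrable_abse dWB).
  - exact: (integrableZl mB _ (integrable_on FB integrable_norm)).
  move=> w Bw; rewrite -mulrBl normrM; apply: ler_wpM2r => //.
  by have /andP[a_le le_b] := h_ab w Bw; rewrite ger0_norm ?subr_ge0 // lerB.
set m := (a + b) / 2.
rewrite (split_integral m FB integrable_pull_out) (split_integral m FB integrable_norm).
have F1 : F (B `&` [set w | h w < m]) by exact: sigma_algebra_setI.
have F2 : F (B `&` ~` [set w | h w < m]).
  by apply: sigma_algebra_setI => //; exact: sigma_algebra_setC.
have -> : (b - a) / 2 ^+ n.+1 = (b - a) / 2 / 2 ^+ n.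
  by rewrite exprS invfM mulrA.
apply: le_trans (ler_normD _ _) _; rewrite mulrDr; apply: lerD.
  have -> : (b - a) / 2 = m - a by rewrite /m; field.
  by apply: IHn => // w [/h_ab /andP[-> _] /ltW].
have -> : (b - a) / 2 = b - m by rewrite /m; field.
by apply: IHn => // w [/h_ab /andP[_ ->] /negP]; rewrite -leNgt andbT.
Qed.

(** The pull-out property of conditional expectation, for the difference [W]
    of a random variable and its conditional expectation. *)
Lemma integral_pull_out : (\int[P]_w (h w * W w)%:E = 0)%E.
Proof.
suff int0 : \int[P]_w (h w * W w) = 0.
  rewrite -[LHS]fineK; first by congr EFin; exact: int0.
  exact: (integrable_fin_num measurableT integrable_pull_out).
set I := \int[P]_w `|W w|.
have I_ge0 : 0 <= I by exact: Rintegral_ge0.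
apply/eqP; rewrite -normr_le0.
apply/ler_addgt0Pr => e e_gt0; rewrite add0r.
have [n n_gt] : exists n, 2 * C * I / e < n%:R.
  exists (Num.truncn (2 * C * I / e)).+1; exact: truncnS_gt.
apply: le_trans (@bisection n setT (- C) C sigma_algebra_setT _) _.
  by move=> w _; rewrite -ler_norml.
rewrite opprK -/I mulrAC ler_pdivrMr ?exprn_gt0 //.
move: n_gt; rewrite ltr_pdivrMr // => n_gt.
apply: (@le_trans _ _ (n%:R * e)); first lra.
by rewrite mulrC ler_pM2l // -natrX ler_nat ltnW // ltn_expl.
Qed.

End PullOut.

(** * The gradient noise has mean zero *)

Section Noise.
Context d (T : measurableType d) (R : realType).
Variables (P : probability T R) (X : normedVectType R).

Lemma integral_sum_EFin (I : eqType) (s : seq I) (f : I -> T -> R) (m : I -> R) :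
  (forall i, i \in s -> P.-integrable setT (EFin \o f i) /\
    (\int[P]_w (f i w)%:E = (m i)%:E)%E) ->
  P.-integrable setT (EFin \o (fun w => \sum_(i <- s) f i w)) /\
  (\int[P]_w (\sum_(i <- s) f i w)%:E = (\sum_(i <- s) m i)%:E)%E.
Proof.
elim: s => [_|i s IHs f_int].
  rewrite (_ : (fun w => \sum_(i <- [::]) f i w) = cst 0); last first.
    by apply/funext => w; rewrite big_nil.
  rewrite big_nil; split; first exact: finite_measure_integrable_cst.
  by under eq_integral do rewrite big_nil; rewrite integral0.
have [|s_int s_mean] := IHs; first by move=> j js; apply: f_int; rewrite inE js orbT.
have [i_int i_mean] := f_int i (mem_head i s).
have sumE : (fun w => \sum_(j <- i :: s) f j w) =
    (fun w => 0 + 1 * f i w + 1 * \sum_(j <- s) f j w).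
  by apply/funext => w; rewrite big_cons add0r !mul1r.
have := integral_affine 0 1 1 i_int s_int i_mean s_mean.
rewrite -sumE big_cons add0r !mul1r => -[sum_int sum_mean]; split => //.
rewrite -sum_mean; apply: eq_integral => w _.
by rewrite big_cons add0r !mul1r.
Qed.

(** In coordinates, [<G - g, x - u>] is a finite sum of products of a bounded
    function determined by the history, a coordinate of [x - u], and the error
    of a conditional expectation, the value of [G - g] at a basis vector. *)
Lemma conditional_noise_mean0 (F : set (set T)) (g G : T -> 'Hom(X, R^o))
    (x : T -> X) (u : X) (B : R) :
  sigma_algebra setT F -> F `<=` measurable -> is_cond_exp_dual P F g G ->
  measurable_wrt F x -> (forall w, `|x w| <= B) ->
  P.-integrable setT (EFin \o (fun w => (G w - g w) (x w - u))) /\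
  (\int[P]_w ((G w - g w) (x w - u))%:E = 0)%E.
Proof.
move=> F_sigma F_meas gG x_F xB.
have [C C_gt0 coordC] := coord_bounded X.
pose c (i : 'I_(\dim {: X})) (v : X) : R := coord (vbasis {: X}) i v.
pose h i w := c i (x w - u).
pose W (i : 'I_(\dim {: X})) w : R :=
  G w (vbasis {: X})`_i - g w (vbasis {: X})`_i.
have cE i : c i = coord (vbasis {: X}) i by [].
have decomp w : (G w - g w) (x w - u) = \sum_i h i w * W i w.
  rewrite {1}[x w - u]coord_fullv linear_sum; apply: eq_bigr => i _.
  by rewrite linearZ /= add_lfunE opp_lfunE.
have W_int i : P.-integrable setT (EFin \o W i).
  have [g_int G_int _ _] := gG (vbasis {: X})`_i.
  exact: (integrableB measurableT G_int g_int).
have W_mean i A : F A -> \int[P]_(w in A) W i w = 0.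
  move=> FA; have [g_int G_int _ gG_eq] := gG (vbasis {: X})`_i.
  have mA := F_meas _ FA.
  have restrict (f : T -> R) :
      P.-integrable setT (EFin \o f) -> P.-integrable A (EFin \o f).
    exact: integrableS.
  rewrite RintegralB //; [|exact: restrict|exact: restrict].
  by rewrite /Rintegral gG_eq // subrr.
have h_F i a : F [set w | h i w < a].
  have -> : [set w | h i w < a] = x @^-1` (c i @^-1` [set y | y < a + c i u]).
    by apply/seteqP; split => w /=; rewrite /h cE linearB /= ltrBlDr.
  apply: x_F; apply: sub_sigma_algebra; apply: open_comp => [v _|].
    exact: linear_form_continuous.
  exact: open_lt.
have h_le i w : `|h i w| <= C * (B + `|u|).
  apply: le_trans (coordC _ _) _; apply: ler_wpM2l; first exact: ltW.
  by apply: le_trans (ler_normB _ _) _; rewrite lerD2r.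
have := @integral_sum_EFin _ (index_enum 'I_(\dim {: X}))
  (fun i w => h i w * W i w) (fun _ => 0).
case=> [i _|sum_int sum_mean].
  split; first exact: (integrable_pull_out F_meas (h_F i) (h_le i) (W_int i)).
  exact: (integral_pull_out F_sigma F_meas (h_F i) (h_le i) (W_int i) (W_mean i)).
rewrite (_ : (fun w => _) = (fun w => \sum_i h i w * W i w)); last exact/funext.
split => //; under eq_integral do rewrite decomp.
by rewrite sum_mean big1.
Qed.

End Noise.

(** * The convergence bounds *)

Theorem corollary1 (R : realType) (X : normedVectType R) (K : set X)
    (l : X -> R)
    (K_compact : compact K) (K_convex : convex_set (K : set (convex_lmodType X)))
    (l_convex : convex_function (setT : set (convex_lmodType X)) l)
    (l_closed : closed_function setT l) :
  exists2 L : R, 0 < L &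
    forall (r : X -> R) (r_ge0 : forall x, K x -> 0 <= r x)
      (r_convex : convex_function (K : set (convex_lmodType X)) r)
      (r_closed : closed_function K r)
      (d : measure_display) (Omega : measurableType d)
      (P : probability Omega R)
      (T : nat) (T_gt0 : (0 < T)%N)
      (A : online_algorithm X Omega) (F : nat -> set (set Omega))
      (g gradl : nat -> Omega -> 'Hom(X, R^o)) (nu : nat -> R) (c1 c2 : R)
      (c1_ge0 : 0 <= c1) (c2_ge0 : 0 <= c2)
      (scheme : acceleration_scheme P T K l r A F g gradl nu)
      (regret : regret_bound P T K r A g c1 c2),
    let f := fun y : X => l y + r y in
    let z := queried A K r g in
    (forall x, K x ->
      ('E_P[fun w => (f (z T w) - f x)%R] <=
       ((c1 + c2 * Num.sqrt (8 * \sum_(1 <= t < T.+1)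
                               weight t ^+ 2 * (nu t ^+ 2 + L ^+ 2)))
        / cumweight T)%:E)%E) /\
    (forall M : R, 0 <= M -> smooth M l ->
     forall x, K x ->
      ('E_P[fun w => (f (z T w) - f x)%R] <=
       ((c1 + c2 * Num.sqrt (8 * \sum_(1 <= t < T.+1)
                               weight t ^+ 2 * nu t ^+ 2)
         + Num.sqrt 2 * c2 * L + 2 * M * c2 ^+ 2)
        / cumweight T)%:E)%E).
Proof.
have [L0 L0_gt0 subgradient_le] := subgradient_bounded l_convex K_compact.
exists (2 * L0); first by rewrite mulr_gt0.
move=> r r_ge0 r_convex r_closed d Omega P T T_gt0 A F g gradl nu c1 c2.
move=> c1_ge0 c2_ge0 scheme regret f z.
have [B KB] : exists B, forall y, K y -> `|y| <= B.
  have [B0 [_ /(_ (`|B0| + 1)) KB]] := compact_bounded K_compact.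
  by exists (`|B0| + 1) => y; apply: KB; rewrite ltr_pwDr // ler_norm.
pose x t w := played A K r g t w.
(* The round 0 gradient is set to 0, as g_0 is, so that the first difference
   G 1 - G 0 is bounded as well. *)
pose G t : Omega -> 'Hom(X, R^o) := if t is 0%N then (fun=> 0) else gradl t.
have GE t : (1 <= t)%N -> G t = gradl t by case: t.
pose dev t w := dual_norm (g t w - G t w).
pose noise (u : X) w := \sum_(1 <= t < T.+1) weight t * (G t w - g t w) (x t w - u).
have [hist_sigma hist_meas _ hist_point _] := scheme_history scheme.
have rangeE t : t \in index_iota 1 T.+1 -> (1 <= t <= T)%N.
  by rewrite mem_index_iota ltnS.
have noise_mean0 u : P.-integrable setT (EFin \o noise u) /\
    (\int[P]_w (noise u w)%:E = 0)%E.
  have := @integral_sum_EFin _ _ _ P _ (index_iota 1 T.+1)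
    (fun t w => weight t * (G t w - g t w) (x t w - u)) (fun _ => 0).
  case=> [t /rangeE t_itv|]; last by rewrite big1.
  have t_ge1 : (1 <= t)%N by case/andP: t_itv.
  have [] := conditional_noise_mean0 u (hist_sigma t) (hist_meas t)
    (scheme_gradient scheme t_itv) (hist_point t t_itv)
    (fun w => KB _ (scheme_in scheme w t_itv)).
  rewrite -GE // => t_int t_mean; split.
    exact: (integrableZl measurableT _ t_int).
  by under eq_integral do rewrite EFinM; rewrite integralZl // t_mean mule0.
have deviation_mean lam :
    P.-integrable setT (EFin \o (fun w =>
      8 * \sum_(1 <= t < T.+1) weight t ^+ 2 * (dev t w ^+ 2 + lam))) /\
    (\int[P]_w (8 * \sum_(1 <= t < T.+1) weight t ^+ 2 * (dev t w ^+ 2 + lam))%:E =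
      (8 * \sum_(1 <= t < T.+1) weight t ^+ 2 * (nu t ^+ 2 + lam))%:E)%E.
  have := @integral_sum_EFin _ _ _ P _ (index_iota 1 T.+1)
    (fun t w => weight t ^+ 2 * (dev t w ^+ 2 + lam))
    (fun t => weight t ^+ 2 * (nu t ^+ 2 + lam)).
  case=> [t /rangeE t_itv|sum_int sum_mean].
    have t_ge1 : (1 <= t)%N by case/andP: t_itv.
    have [dev_int _ _ dev_mean] := scheme_variance scheme t_itv.
    have {}dev_mean : (\int[P]_w (dev t w ^+ 2)%:E = (nu t ^+ 2)%:E)%E.
      rewrite /dev GE // (dev_mean _ (sigma_algebra_setT (hist_sigma t))).
      by have := expectation_cst P (nu t ^+ 2); rewrite unlock.
    rewrite -GE // in dev_int.
    have := integral_affine (weight t ^+ 2 * lam) (weight t ^+ 2) 0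
      dev_int dev_int dev_mean dev_mean.
    rewrite mul0r addr0 addrC -mulrDr => -[].
    rewrite (_ : (fun w => _) = (fun w => weight t ^+ 2 * (dev t w ^+ 2 + lam))).
      move=> t_int <-; split => //; apply: eq_integral => w _.
      by rewrite mul0r addr0 addrC -mulrDr.
    by apply/funext => w; rewrite mul0r addr0 addrC -mulrDr.
  split; first exact: (integrableZl measurableT _ sum_int).
  by under eq_integral do rewrite EFinM; rewrite integralZl // sum_mean.
have z_G : {ae P, forall w, forall t, (1 <= t <= T)%N ->
    subdifferential l (z t w) (G t w)}.
  apply/ae_foralln => t; have [t_itv|t_out] := boolP (1 <= t <= T)%N; last exact: aeW.
  move: (scheme_subgradient scheme t_itv); apply: filterS => w z_grad _.
  by rewrite GE //; case/andP: t_itv.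
have conclude lam C u : 0 <= lam ->
    {ae P, forall w, cumweight T * (f (z T w) - f u) <=
      C + c2 * Num.sqrt (8 * \sum_(1 <= t < T.+1) weight t ^+ 2 * (dev t w ^+ 2 + lam))
      + noise u w} ->
    ('E_P[fun w => (f (z T w) - f u)%R] <=
     ((C + c2 * Num.sqrt (8 * \sum_(1 <= t < T.+1) weight t ^+ 2 * (nu t ^+ 2 + lam)))
      / cumweight T)%:E)%E.
  move=> lam_ge0 path_le.
  have [dev_int dev_mean] := deviation_mean lam.
  have [noise_int noise_mean] := noise_mean0 u.
  apply: (expectation_sqrt_le _ c2_ge0 dev_int noise_int _ dev_mean noise_mean path_le).
    exact: cumweight_gt0.
  move=> w; rewrite mulr_ge0 //; apply: sumr_ge0 => t _.
  by rewrite mulr_ge0 ?sqr_ge0 // addr_ge0 ?sqr_ge0.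
have Kx w t : (1 <= t <= T)%N -> K (x t w) by exact: (scheme_in scheme w).
have g0 w : g 0%N w = 0 by exact: scheme_first_hint scheme w.
have G_le w : (forall t, (1 <= t <= T)%N -> subdifferential l (z t w) (G t w)) ->
    forall t, (t <= T)%N -> dual_norm (G t w) <= L0.
  move=> z_Gw [|t] t_le.
    apply: dual_norm_le => v _; rewrite /= lfunE /=; exact: ltW.
  apply: (subgradient_le (z t.+1 w)); last exact: z_Gw.
  apply: (averaged_mem (x := fun s => x s w) K_convex) => // s /andP[s_ge1 s_le].
  by apply: Kx; rewrite s_ge1 (leq_trans s_le).
split => [u Ku|M M_ge0 l_smooth u Ku].
  apply: conclude; first exact: sqr_ge0.
  move: z_G regret; apply: filterS2 => w z_Gw regret_w.
  exact: (pathwise_lipschitz K_convex r_convex T_gt0 (g0 w) erefl (Kx w) z_Gw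
    c2_ge0 (G_le w z_Gw) (regret_w u Ku)).
have := @conclude 0 (c1 + Num.sqrt 2 * c2 * (2 * L0) + 2 * M * c2 ^+ 2) u (lexx 0).
under eq_bigr do rewrite addr0.
rewrite [X in X / _](_ : _ = c1 + c2 * Num.sqrt (8 * \sum_(1 <= t < T.+1)
    weight t ^+ 2 * nu t ^+ 2) + Num.sqrt 2 * c2 * (2 * L0) + 2 * M * c2 ^+ 2);
  last by ring.
apply; move: z_G regret; apply: filterS2 => w z_Gw regret_w.
under eq_bigr do rewrite addr0.
exact: (pathwise_smooth K_convex r_convex T_gt0 (g0 w) erefl (Kx w) z_Gw
  c2_ge0 (G_le w z_Gw) (regret_w u Ku) M_ge0 l_smooth).
Qed.
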